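(* For all integers $n\geq 0$, $$a_{1^{3}3^{-1}4^{-4}}(4n)>0,\quad a_{1^{3}3^{-1}4^{-4}}(4n+1)<0,\quad a_{1^{3}3^{-1}4^{-4}}(4n+2)=0,\quad a_{1^{3}3^{-1}4^{-4}}(4n+3)>0.$$
   Context: For $|q|<1$ (or as formal power series in $q$) let $f_j:=(q^j;q^j)_\infty=\prod_{k\ge 1}(1-q^{jk})$ for each positive integer $j$. The integers $a_{1^{3}3^{-1}4^{-4}}(n)$, $n\ge 0$, are defined by $\sum_{n=0}^\infty a_{1^{3}3^{-1}4^{-4}}(n)q^n=\dfrac{f_1^3}{f_3f_4^4}$. *)

(* Defs.v *)
From HB Require Import structures.
From mathcomp Require Import all_boot all_order all_algebra.
From mathcomp Require Import boolp.

Set Implicit Arguments.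
Unset Strict Implicit.
Unset Printing Implicit Defensive.

Import Order.TTheory GRing.Theory Num.Theory.
Local Open Scope ring_scope.

(* Formal power series in one variable q; the coercion sends a series to its
   coefficient function. *)
Record fps (R : Type) := FPS { fcoef :> nat -> R }.

HB.instance Definition _ (R : Type) := gen_eqMixin (fps R).
HB.instance Definition _ (R : Type) := gen_choiceMixin (fps R).

Lemma fpsP (R : Type) (f g : fps R) : (forall n, f n = g n) -> f = g.
Proof. by case: f g => [f] [g] /= /funext ->. Qed.

Section Zmodule.
Variable R : zmodType.
Implicit Types f g h : fps R.

Definition fps0 : fps R := FPS (fun=> 0).
Definition fps_opp f := FPS (fun n => - f n).
Definition fps_add f g := FPS (fun n => f n + g n).

Fact fps_addA : associative fps_add.
Proof. by move=> f g h; apply: fpsP => n /=; rewrite addrA. Qed.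
Fact fps_addC : commutative fps_add.
Proof. by move=> f g; apply: fpsP => n /=; rewrite addrC. Qed.
Fact fps_add0 : left_id fps0 fps_add.
Proof. by move=> f; apply: fpsP => n /=; rewrite add0r. Qed.
Fact fps_addN : left_inverse fps0 fps_opp fps_add.
Proof. by move=> f; apply: fpsP => n /=; rewrite addNr. Qed.

HB.instance Definition _ :=
  GRing.isZmodule.Build (fps R) fps_addA fps_addC fps_add0 fps_addN.

Lemma fcoef0 n : (0 : fps R) n = 0. Proof. by []. Qed.
Lemma fcoefD f g n : (f + g) n = f n + g n. Proof. by []. Qed.
Lemma fcoefN f n : (- f) n = - f n. Proof. by []. Qed.
Lemma fcoefB f g n : (f - g) n = f n - g n. Proof. by []. Qed.
Lemma fcoef_sum I (r : seq I) (P : pred I) (F : I -> fps R) n :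
  (\sum_(i <- r | P i) F i) n = \sum_(i <- r | P i) F i n.
Proof. by elim/big_rec2: _ => // i x y _ <-. Qed.

End Zmodule.

Section Ring.
Variable R : comNzRingType.
Implicit Types f g h : fps R.

Definition fps1 : fps R := FPS (fun n => (n == 0%N)%:R).
Definition fps_mul f g : fps R :=
  FPS (fun n => \sum_(i < n.+1) f i * g (n - i)%N).

Definition fps_trunc N f : {poly R} := \poly_(i < N) f i.

Fact fps_mul_trunc N f g n : (n < N)%N ->
  fps_mul f g n = (fps_trunc N f * fps_trunc N g)`_n.
Proof.
move=> ltnN; rewrite coefM /=; apply: eq_bigr => i _; rewrite !coef_poly.
have -> : (i < N)%N by apply: leq_ltn_trans ltnN; rewrite -ltnS.
by rewrite (leq_ltn_trans (leq_subr _ _) ltnN).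
Qed.

Fact fps_mulC : commutative fps_mul.
Proof.
by move=> f g; apply: fpsP => n; rewrite !(@fps_mul_trunc n.+1) // mulrC.
Qed.

Fact fps_mulA : associative fps_mul.
Proof.
move=> f g h; apply: fpsP => n.
set N := n.+1.
transitivity ((fps_trunc N f * (fps_trunc N g * fps_trunc N h))`_n).
  rewrite coefM /=; apply: eq_bigr => i _; rewrite coef_poly ltn_ord.
  by congr (_ * _); rewrite -fps_mul_trunc // ltnS leq_subr.
rewrite mulrA coefM /=; apply: eq_bigr => i _; congr (_ * _).
  by rewrite -fps_mul_trunc // ltn_ord.
by rewrite coef_poly ltnS leq_subr.
Qed.

Fact fps_mul1 : left_id fps1 fps_mul.
Proof.
move=> f; apply: fpsP => n /=; rewrite big_ord_recl /= subn0 mul1r.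
by rewrite big1 ?addr0 // => i _; rewrite mul0r.
Qed.

Fact fps_mulDl : left_distributive fps_mul (@fps_add R).
Proof.
move=> f g h; apply: fpsP => n /=; rewrite -big_split /=.
by apply: eq_bigr => i _; rewrite mulrDl.
Qed.

Fact fps_1_neq0 : fps1 != 0.
Proof.
by apply/eqP => /(congr1 (fun f : fps R => f 0%N)) /eqP; rewrite /= oner_eq0.
Qed.

HB.instance Definition _ := GRing.Zmodule_isComNzRing.Build (fps R)
  fps_mulA fps_mulC fps_mul1 fps_mulDl fps_1_neq0.

Lemma fcoef1 n : (1 : fps R) n = (n == 0%N)%:R. Proof. by []. Qed.
Lemma fcoefM f g n : (f * g) n = \sum_(i < n.+1) f i * g (n - i)%N.
Proof. by []. Qed.

Lemma fcoefM0 f g : (f * g) 0%N = f 0%N * g 0%N.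
Proof. by rewrite fcoefM big_ord_recl big_ord0 addr0. Qed.

Lemma fcoef_exp_lt f k n : f 0%N = 0 -> (n < k)%N -> (f ^+ k) n = 0.
Proof.
move=> f0; elim: k n => // k IHk n ltnk.
rewrite exprS fcoefM big_ord_recl f0 mul0r add0r big1 // => i _.
by rewrite IHk ?mulr0 // lift0; case: n ltnk i => [|n] ? [] //= i ?;
   rewrite subSS (leq_ltn_trans (leq_subr _ _)).
Qed.

Definition fpsX : fps R := FPS (fun n => (n == 1%N)%:R).

Lemma fcoefMXn f m n : (n < m)%N -> (f * fpsX ^+ m) n = 0.
Proof.
move=> ltnm; rewrite fcoefM big1 // => i _; rewrite fcoef_exp_lt ?mulr0 //.
exact: leq_ltn_trans (leq_subr _ _) ltnm.
Qed.

End Ring.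

Section UnitRing.
Variable R : comUnitRingType.
Implicit Types f g : fps R.

Definition fps_unit : pred (fps R) := fun f => f 0%N \is a GRing.unit.

(* Geometric series: with c the inverse of the constant coefficient of f, the
   inverse of f is c times the sum of the (1 - c f)^k, whose terms with k > n
   do not contribute to the coefficient of q^n. *)
Definition fps_inv f : fps R :=
  if fps_unit f then
    let c := (f 0%N)^-1 in
    let u : fps R := 1 - FPS (fun n => c * f n) in
    FPS (fun n => c * (\sum_(k < n.+1) u ^+ k) n)
  else f.

Fact fps_mulVx : {in fps_unit, left_inverse 1 fps_inv *%R}.
Proof.
move=> f fU; rewrite /fps_inv ifT //; have {}fU : f 0%N \is a GRing.unit by [].
set c := _^-1; set g := FPS (fun n => c * f n); set u := 1 - g.
have u0 : u 0%N = 0 by rewrite fcoefB fcoef1 /= mulVr // subrr.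
have sum_stable n N : (n <= N)%N ->
    (\sum_(k < N.+1) u ^+ k) n = (\sum_(k < n.+1) u ^+ k) n.
  move=> /subnKC <-; elim: (N - n)%N => [|d IHd]; first by rewrite addn0.
  rewrite addnS big_ord_recr fcoefD IHd (@fcoef_exp_lt _ u) ?addr0 //.
  by rewrite /= ltnS leq_addr.
apply: fpsP => n; rewrite fcoefM.
transitivity (((\sum_(k < n.+1) u ^+ k) * g) n).
  rewrite fcoefM; apply: eq_bigr => i _ /=.
  rewrite -(sum_stable i n); last by rewrite -ltnS.
  by rewrite mulrCA mulrA.
have -> : g = - (u - 1) by rewrite opprB subKr.
rewrite mulrC mulNr -subrX1 opprB fcoefB.
by rewrite (@fcoef_exp_lt _ u) ?subr0.
Qed.

Fact fps_unitPl f g : g * f = 1 -> fps_unit f.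
Proof.
move=> /(congr1 (fun h : fps R => h 0%N)); rewrite fcoefM0 fcoef1 /= => gf1.
by apply/unitrPr; exists (g 0%N); rewrite mulrC.
Qed.

Fact fps_inv_out : {in [predC fps_unit], fps_inv =1 id}.
Proof. by move=> f fNU; rewrite /fps_inv ifN. Qed.

HB.instance Definition _ := GRing.ComNzRing_hasMulInverse.Build (fps R)
  fps_mulVx fps_unitPl fps_inv_out.

Lemma fps_unitE f : (f \is a GRing.unit) = (f 0%N \is a GRing.unit).
Proof. by []. Qed.

End UnitRing.

Local Notation q := (fpsX int).

(* f_j = (q^j; q^j)_oo.  For j > 0 the factors with k > n are 1 modulo q^(n+1),
   so the coefficient of q^n is that of any partial product of length >= n; see
   eulerf_lim. *)
Definition eulerf (j : nat) : fps int :=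
  FPS (fun n => (\prod_(1 <= k < n.+1) (1 - q ^+ (j * k))) n).

Lemma eulerf_lim (j n N : nat) : (0 < j)%N -> (n <= N)%N ->
  (\prod_(1 <= k < N.+1) (1 - q ^+ (j * k))) n = eulerf j n.
Proof.
have fcoefMB (f g : fps int) : (f * (1 - g)) n = f n - (f * g) n.
  by rewrite mulrBr mulr1.
move=> j0 /subnKC <-; elim: (N - n)%N => [|d IHd]; first by rewrite addn0.
rewrite addnS big_nat_recr // fcoefMB IHd fcoefMXn ?subr0 //.
by apply: leq_trans (leq_pmull _ j0); rewrite ltnS leq_addr.
Qed.

(* Hence the quotient defining a133144 is a genuine division. *)
Lemma eulerf_unit (j : nat) : eulerf j \is a GRing.unit.
Proof. by rewrite fps_unitE /= big_geq // unitr1. Qed.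

(* The coefficients a_{1^3 3^{-1} 4^{-4}}(n) of f_1^3 / (f_3 f_4^4). *)
Definition a133144 (n : nat) : int :=
  (eulerf 1 ^+ 3 / (eulerf 3 * eulerf 4 ^+ 4)) n.

(* Main.v *)
(* The series f_1^3 / f_3 is the theta series of the lattice Z[w], w a primitive
   cube root of unity, weighted by an additive character modulo sqrt(-3)
   (cubic_theta, where chi3 is twice the real part of the character); this comes
   from squaring Euler's pentagonal number series.  The lattice elements of
   even norm are the multiples of 2, which reproduce the same series in q^4.  The
   elements of odd norm form three classes modulo 2, permuted by multiplication
   by w, so their contribution is three times that of the class inside
   Z[sqrt(-3)], where m^2 + 3 n^2 with m + n odd is 1 or 3 modulo 4.  This is a
   4-dissection of f_1^3 / f_3, and after division by f_4^4 the triple product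
   turns each of its three parts, up to sign, into a product of series with
   nonnegative coefficients. *)
Require Import Defs.
From mathcomp Require Import all_boot all_order all_algebra.
From mathcomp Require Import finmap.
From mathcomp Require Import boolp classical_sets functions cardinality fsbigop.
From mathcomp Require Import zify ring.

Set Implicit Arguments.
Unset Strict Implicit.
Unset Printing Implicit Defensive.

Import Order.TTheory GRing.Theory Num.Theory.
Local Open Scope ring_scope.

Local Notation q := (fpsX int).

(** * Series summed over an index type *)

(* The sum of [w i * q ^ e i]; a coefficient is 0 (the value of a sum with
   infinite support) unless the corresponding fibre of [e] is finite, up to
   indices of weight 0. *)
Definition qser (I : choiceType) (e w : I -> int) : fps int :=
  FPS (fun n => \sum_(i \in [set i | e i = n%:Z]%classic) w i).

Definition finfib (I : choiceType) (e : I -> int) :=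
  forall n : nat, finite_set [set i | e i = n%:Z]%classic.

Lemma qserE (I : choiceType) (e w : I -> int) (s : seq I) (n : nat) :
  uniq s -> (forall i, e i = n%:Z -> i \in s) ->
  qser e w n = \sum_(i <- s | e i == n%:Z) w i.
Proof.
move=> us sP /=; rewrite (fsbigE [seq i <- s | e i == n%:Z]) ?filter_uniq //.
- rewrite big_filter_cond; apply: eq_bigl => i.
  by case: eqP => ei /=; [apply/mem_set | ].
- by move=> i /=; rewrite mem_filter => /andP[/eqP].
- by move=> i ei; rewrite mem_filter ei eqxx sP.
Qed.

Lemma finfib_cover (I : choiceType) (e : I -> int) (n : nat) :
  finfib e -> (forall i, 0 <= e i) ->
  exists2 s : seq I, uniq s & forall i, e i <= n%:Z -> i \in s.
Proof.
move=> fe e0.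
exists (undup (flatten [seq fset_set [set i | e i = k%:Z]%classic : seq I
                       | k <- iota 0 n.+1])); first exact: undup_uniq.
move=> i ein; rewrite mem_undup; apply/flatten_mapP.
exists `|e i|%N; first by rewrite mem_iota; move: (e0 i); lia.
rewrite in_fset_set //; apply/mem_set => /=.
by move: (e0 i); lia.
Qed.

Lemma qserM (I J : choiceType) (e w : I -> int) (e' w' : J -> int) :
  finfib e -> finfib e' -> (forall i, 0 <= e i) -> (forall j, 0 <= e' j) ->
  qser e w * qser e' w' =
  qser (fun p : I * J => e p.1 + e' p.2) (fun p => w p.1 * w' p.2).
Proof.
move=> fe fe' e0 e0'; apply: fpsP => n.
have [s us sP] := finfib_cover n fe e0.
have [t ut tP] := finfib_cover n fe' e0'.
rewrite (@qserE _ _ _ [seq (i, j) | i <- s, j <- t]); first last.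
- case=> i j /= eij; apply/allpairsP; exists (i, j); split => //=.
    by apply: sP; move: (e0' j); lia.
  by apply: tP; move: (e0 i); lia.
- by apply: allpairs_uniq => // -[a b] [c d] _ _ /= [-> ->].
rewrite big_mkcond big_allpairs fcoefM.
(* Both sides become sums over the finite box [s] by [t]; each pair whose total exponent is [n] is
   then counted for exactly one [k], namely [k = e i]. *)
transitivity (\sum_(k < n.+1) \sum_(i <- s) \sum_(j <- t)
   (if (e i == k%:Z) && (e' j == (n - k)%:Z) then w i * w' j else 0)).
  apply: eq_bigr => k _.
  rewrite (@qserE _ _ _ s) //; last first.
    by move=> i ei; apply: sP; move: (ltn_ord k); lia.
  rewrite (@qserE _ _ _ t) //; last first.
    by move=> j ej; apply: tP; move: (ltn_ord k); lia.
  rewrite big_mkcond mulr_suml; apply: eq_bigr => i _.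
  rewrite big_mkcond mulr_sumr; apply: eq_bigr => j _.
  by case: ifP => _ /=; case: ifP; rewrite ?mul0r ?mulr0.
rewrite exchange_big; apply: eq_bigr => i _.
rewrite exchange_big; apply: eq_bigr => j _ /=.
have [a ea] : exists a : nat, e i = a%:Z by exists `|e i|%N; move: (e0 i); lia.
have [b eb] : exists b : nat, e' j = b%:Z.
  by exists `|e' j|%N; move: (e0' j); lia.
case: eqP => eab; last first.
  by rewrite big1 // => k _; case: ifP => [|//]; move: (ltn_ord k); lia.
have lta : (a < n.+1)%N by lia.
rewrite (bigD1 (Ordinal lta)) //= ea eqxx ifT ?big1 ?addr0 //; last by lia.
by move=> k kna; rewrite ifF //; move/eqP: kna => kna; apply/negP => /andP[/eqP h];
  case: kna; apply: val_inj => /=; lia.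
Qed.

(** All decompositions of lattices by parity below are instances of this one, with [h] and [g]
    parametrizing the two classes. *)
Lemma qser_split (I J K : choiceType) (h : J -> I) (g : K -> I) (e w : I -> int) :
  finfib e -> injective h -> injective g -> (forall j k, h j <> g k) ->
  (forall i, (exists j, i = h j) \/ (exists k, i = g k)) ->
  qser e w = qser (e \o h) (w \o h) + qser (e \o g) (w \o g).
Proof.
move=> fe hI gI hg cov; apply: fpsP => n; rewrite fcoefD /=.
set A := [set j | e (h j) = n%:Z]%classic.
set B := [set j | e (g j) = n%:Z]%classic.
have -> : [set i | e i = n%:Z]%classic = ((h @` A) `|` (g @` B))%classic.
  apply/seteqP; split => [i /= ei|i /= [[j Aj <-]|[j Bj <-]] //].
  by case: (cov i) => -[j ij]; [left|right]; exists j => //; rewrite /A /B /= -ij.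
rewrite fsbigU0 /=.
- by congr (_ + _); rewrite fsbig_image //; apply: in2W => x y; [apply: hI|apply: gI].
- by apply: sub_finite_set (fe n) => _ [j Aj <-].
- by apply: sub_finite_set (fe n) => _ [j Aj <-].
- by move=> _ [[j _ <-] [k _ /esym/hg]].
Qed.

Lemma eq_qser (I : choiceType) (e w e' w' : I -> int) :
  e =1 e' -> w =1 w' -> qser e w = qser e' w'.
Proof. by move=> /funext -> /funext ->. Qed.

Lemma reindex_qser (I J : choiceType) (h : J -> I) (e w : I -> int) :
  bijective h -> qser e w = qser (e \o h) (w \o h).
Proof.
case=> g hK gK; apply: fpsP => n /=.
apply: (reindex_fsbig h); split => [j //|j k _ _ /(can_inj hK) //|i /= ei].
by exists (g i); rewrite /= gK.
Qed.

Lemma qserN (I : choiceType) (e w : I -> int) :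
  qser e (fun i => - w i) = - qser e w.
Proof.
apply: fpsP => n; rewrite fcoefN /= -mulN1r mulr_fsumr.
by apply: eq_fsbigr => i _; rewrite mulN1r.
Qed.

Lemma fcoefXM (k : nat) (f : fps int) (n : nat) :
  (q ^+ k * f) n = if (k <= n)%N then f (n - k)%N else 0.
Proof.
elim: k n => [|k IHk] n; first by rewrite expr0 mul1r subn0.
rewrite exprS -mulrA fcoefM; case: n => [|n].
  by rewrite big_ord_recl big_ord0 /= mul0r.
rewrite big_ord_recl mul0r add0r big_ord_recl mul1r lift0 subSS subn0 IHk.
by rewrite big1 ?addr0 // => i _; rewrite mul0r.
Qed.

Lemma qserXM (I : choiceType) (k : nat) (e w : I -> int) :
  (forall i, 0 <= e i) ->
  q ^+ k * qser e w = qser (fun i => e i + k%:Z) w.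
Proof.
move=> e0; apply: fpsP => n; rewrite fcoefXM; case: leqP => kn /=.
  by apply: eq_fsbigl; apply/seteqP; split => i /=; lia.
by rewrite fsbig1 // => i /=; move: (e0 i); lia.
Qed.

(** * Congruences modulo powers of q and infinite products *)

Definition eqm (n : nat) (f g : fps int) := forall m, (m <= n)%N -> f m = g m.

Lemma eqm_refl n f : eqm n f f. Proof. by []. Qed.

Lemma eqm_trans n f g h : eqm n f g -> eqm n g h -> eqm n f h.
Proof. by move=> fg gh m mn; rewrite fg ?gh. Qed.

Lemma eqm_leq m n f g : (m <= n)%N -> eqm n f g -> eqm m f g.
Proof. by move=> mn fg k km; apply: fg; apply: leq_trans mn. Qed.

Lemma eqmD n f g f' g' : eqm n f g -> eqm n f' g' -> eqm n (f + f') (g + g').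
Proof. by move=> fg fg' m mn; rewrite !fcoefD fg ?fg'. Qed.

Lemma eqmN n f g : eqm n f g -> eqm n (- f) (- g).
Proof. by move=> fg m mn; rewrite !fcoefN fg. Qed.

Lemma eqmM n f g f' g' : eqm n f g -> eqm n f' g' -> eqm n (f * f') (g * g').
Proof.
move=> fg fg' m mn; rewrite !fcoefM; apply: eq_bigr => i _.
by rewrite fg ?fg' //; move: (ltn_ord i); lia.
Qed.

Lemma eqm_sum n (I : Type) (r : seq I) (P : pred I) (F G : I -> fps int) :
  (forall i, P i -> eqm n (F i) (G i)) ->
  eqm n (\sum_(i <- r | P i) F i) (\sum_(i <- r | P i) G i).
Proof. by move=> FG; elim/big_rec2: _ => // i x y Pi; apply: eqmD; apply: FG. Qed.

Lemma eqm_prod1 n (I : Type) (r : seq I) (P : pred I) (F : I -> fps int) :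
  (forall i, P i -> eqm n (F i) 1) -> eqm n (\prod_(i <- r | P i) F i) 1.
Proof.
move=> F1; elim/big_rec: _ => // i x Pi x1.
by rewrite -[X in eqm _ _ X](mulr1 1); apply: eqmM => //; apply: F1.
Qed.

Lemma eqmXn n k : (n < k)%N -> eqm n (q ^+ k) 0.
Proof. by move=> nk m mn; rewrite fcoef_exp_lt //; apply: leq_ltn_trans nk. Qed.

Lemma eqmMXn n k f : (n < k)%N -> eqm n (f * q ^+ k) 0.
Proof. by move=> nk; rewrite -[X in eqm _ _ X](mulr0 f); apply/eqmM/eqmXn. Qed.

(** A convergence criterion tuned to [iprod]: the factors with [k >= n] are 1 modulo [q ^+ n.+1], so
    the first [n] factors already determine the coefficient of [q ^+ n]. *)
Definition conv1 (g : nat -> fps int) := forall k, eqm k (g k) 1.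

Definition iprod (g : nat -> fps int) : fps int :=
  FPS (fun n => (\prod_(k < n) g k) n).

Lemma iprod_eqm g n N : conv1 g -> (n <= N)%N ->
  eqm n (iprod g) (\prod_(k < N) g k).
Proof.
move=> cg nN m mn /=; have mN := leq_trans mn nN.
rewrite -!(big_mkord xpredT) [in RHS](big_cat_nat (n := m)) //.
rewrite -[\prod_(0 <= k < m) g k in LHS]mulr1.
suff h1: eqm m 1 (\prod_(m <= i < N) g i).
  exact: (eqmM (@eqm_refl m _) h1).
move=> k km; rewrite big_nat_cond; apply/esym/(@eqm_prod1 m) => // i /andP[/andP[mi _] _].
exact: eqm_leq (cg i).
Qed.

Lemma conv1M g h : conv1 g -> conv1 h -> conv1 (fun k => g k * h k).
Proof. by move=> cg ch k; rewrite -[X in eqm _ _ X](mulr1 1); apply: eqmM. Qed.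

Lemma iprodM g h : conv1 g -> conv1 h ->
  iprod g * iprod h = iprod (fun k => g k * h k).
Proof.
move=> cg ch; apply: fpsP => n.
transitivity (((\prod_(k < n) g k) * \prod_(k < n) h k) n).
  have eg := iprod_eqm cg (leqnn n); have eh := iprod_eqm ch (leqnn n).
  exact: (eqmM eg eh).
by rewrite -big_split.
Qed.

(** Regrouping in blocks of [m] consecutive factors sorts them by the residue of the index modulo
    [m]; this is how products over residue classes are compared with full ones. *)
Lemma iprod_block g m : (0 < m)%N -> conv1 g ->
  iprod g = iprod (fun k => \prod_(i < m) g (m * k + i)%N).
Proof.
move=> m0 cg; apply: fpsP => n.
rewrite (@iprod_eqm _ n (m * n)) //; last exact: leq_pmull.
rewrite [in RHS]/iprod [RHS]/fcoef; congr (fcoef _ n).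
elim: n => [|n IHn]; first by rewrite muln0 !big_ord0.
rewrite big_ord_recr -IHn (_ : m * n.+1 = m * n + m)%N; last by rewrite mulnS addnC.
by rewrite big_split_ord.
Qed.

Lemma eq_iprod g h : g =1 h -> iprod g = iprod h.
Proof. by move=> gh; apply: fpsP => n /=; congr (fcoef _ n); apply: eq_bigr => i _. Qed.

Lemma eulerfE j : eulerf j = iprod (fun k => 1 - q ^+ (j * k.+1)).
Proof. by apply: fpsP => n /=; rewrite big_add1 big_mkord. Qed.

Lemma conv1D g : (forall k, eqm k (g k) 0) -> conv1 (fun k => 1 + g k).
Proof.
by move=> g0 k; rewrite -[X in eqm _ _ X]addr0; apply: eqmD => //; apply: eqm_refl.
Qed.

Lemma eqm0D n f g : eqm n f 0 -> eqm n g 0 -> eqm n (f + g) 0.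
Proof. by move=> f0 g0; rewrite -[X in eqm _ _ X]addr0; apply: eqmD. Qed.

Lemma eqm0N n f : eqm n f 0 -> eqm n (- f) 0.
Proof. by move=> f0; rewrite -[X in eqm _ _ X]oppr0; apply: eqmN. Qed.

Lemma eqm_sum0 n (I : Type) (r : seq I) (P : pred I) (F : I -> fps int) :
  (forall i, P i -> eqm n (F i) 0) -> eqm n (\sum_(i <- r | P i) F i) 0.
Proof. by move=> F0; elim/big_rec: _ => // i x Pi; apply/eqm0D/F0. Qed.

(** * Gaussian binomial coefficients and the triple product *)

Section QBinomial.
Variables (R : comNzRingType) (Q : R).

Fixpoint qbin (n i : nat) : R :=
  match i, n with
  | 0, _ => 1
  | _.+1, 0 => 0
  | i'.+1, n'.+1 => qbin n' i' + Q ^+ i * qbin n' i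
  end.

Arguments qbin : simpl never.

Lemma qbinn0 n : qbin n 0 = 1. Proof. by case: n. Qed.

Lemma qbinS n i : qbin n.+1 i.+1 = qbin n i + Q ^+ i.+1 * qbin n i.+1.
Proof. by []. Qed.

Lemma qbin_small n i : (n < i)%N -> qbin n i = 0.
Proof.
elim: n i => [|n IHn] [|i] // ni.
by rewrite qbinS !IHn ?mulr0 ?addr0 // ltnW.
Qed.

Lemma qbin_nn n : qbin n n = 1.
Proof. by elim: n => // n IHn; rewrite qbinS IHn qbin_small // mulr0 addr0. Qed.

(** Exponents such as [n - i] use truncated subtraction and are only meaningful for [i <= n];
    outside that range the binomial vanishes. *)
Lemma qbin_expr n i k m : (i <= n -> k = m)%N ->
  Q ^+ k * qbin n i = Q ^+ m * qbin n i.
Proof.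
by case: (leqP i n) => [_ -> //|ni _]; rewrite qbin_small ?mulr0.
Qed.

Lemma qbinS' n i : qbin n.+1 i.+1 = Q ^+ (n - i) * qbin n i + qbin n i.+1.
Proof.
elim: n i => [|n IHn] [|i].
- by rewrite /qbin subn0 expr0 mulr0 mulr1.
- by rewrite /qbin !mulr0 addr0.
  rewrite qbinS [qbin n.+1 1 in LHS]IHn [qbin n.+1 1 in RHS]qbinS.
  by rewrite !qbinn0 !subn0 !exprS expr0; ring.
rewrite qbinS [qbin n.+1 i.+1 in LHS]IHn [qbin n.+1 i.+2 in LHS]IHn.
rewrite [qbin n.+1 i.+1 in RHS]qbinS.
rewrite [qbin n.+1 i.+2]qbinS subSS mulrDr mulrDr !mulrA -!exprD.
by rewrite (@qbin_expr _ _ (i.+2 + _) (n - i + i.+1)); [ring | lia].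
Qed.

(** Expand the first copy of [qbin n.+1 i.+1] by one Pascal rule and the copy multiplied by
    [Q ^+ i.+1] by the other: the terms in [qbin n i.+1] cancel. *)
Lemma qbin_absorb n i : (i <= n)%N ->
  (1 - Q ^+ i.+1) * qbin n.+1 i.+1 = (1 - Q ^+ n.+1) * qbin n i.
Proof.
move=> ni; rewrite mulrBl mul1r {1}qbinS qbinS' mulrDr mulrA -exprD.
by rewrite (_ : (i.+1 + (n - i) = n.+1)%N); [ring | lia].
Qed.

Lemma qbin_prod n i : (i <= n)%N ->
  qbin n i * \prod_(k < i) (1 - Q ^+ k.+1) = \prod_(k < i) (1 - Q ^+ (n - k)).
Proof.
elim: i n => [|i IHi] n ni; first by rewrite qbinn0 !big_ord0 mulr1.
case: n ni => // n ni; rewrite big_ord_recr /=.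
rewrite [RHS]big_ord_recl subn0.
under [in RHS]eq_bigr => k _ do rewrite lift0 subSS.
by rewrite -IHi // [RHS]mulrA -qbin_absorb //; ring.
Qed.

(** Both Pascal rules in turn, since each new factor of the triple product raises the row by two.
    The tests on [j] stand for entries of negative index being 0. *)
Lemma qbinSS n j :
  qbin n.+2 j = (if (0 < j)%N then (1 + Q ^+ n.+1) * qbin n j.-1 else 0)
    + (if (1 < j)%N then Q ^+ (n.+2 - j) * qbin n j.-2 else 0) + Q ^+ j * qbin n j.
Proof.
case: j => [|[|j]]; first by rewrite /= !qbinn0 expr0 mulr1 !add0r.
  by rewrite qbinS qbinS' subn0 /= !qbinn0 !exprS expr0; ring.
rewrite qbinS !qbinS' mulrDr mulrA -exprD !subSS /=.
by rewrite (@qbin_expr _ _ (j.+2 + _) n.+1); [ring | lia].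
Qed.

(* One step of the finite triple product: [t] lists the terms of the theta
   series, re-indexed so that they start at [t 0]. *)
Lemma qbin_step n (g : R) (t : nat -> R) :
  (forall i, (i <= n)%N ->
    (g - 1 - Q ^+ n.+1) * t i.+1 = Q ^+ (n - i) * t i.+2 + Q ^+ i * t i) ->
  (\sum_(i < n.+1) qbin n i * t i.+1) * g = \sum_(i < n.+3) qbin n.+2 i * t i.
Proof.
move=> gt; under [RHS]eq_bigr => i _ do rewrite qbinSS !(mulrDl _ _ (t _)).
rewrite !big_split /= mulr_suml.
transitivity (\sum_(i < n.+1) ((1 + Q ^+ n.+1) * qbin n i * t i.+1
   + Q ^+ (n - i) * qbin n i * t i.+2 + Q ^+ i * qbin n i * t i)).
  apply: eq_bigr => i _; have /gt gti : (i <= n)%N by rewrite -ltnS.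
  rewrite -(subrK (Q ^+ n.+1) g) -(subrK 1 (g - _)).
  transitivity (qbin n i * ((g - 1 - Q ^+ n.+1) * t i.+1)
    + (1 + Q ^+ n.+1) * qbin n i * t i.+1); first by ring.
  by rewrite gti; ring.
rewrite !big_split /=; congr (_ + _ + _).
- rewrite [RHS]big_ord_recl mul0r add0r.
  under [RHS]eq_bigr => i _ do rewrite lift0 /=.
  by rewrite [RHS]big_ord_recr /= qbin_small // mulr0 mul0r addr0.
- rewrite [RHS]big_ord_recl mul0r add0r [RHS]big_ord_recl mul0r add0r.
  by apply: eq_bigr => i _; rewrite !lift0 !subSS.
- rewrite [RHS]big_ord_recr [X in _ = X + _]big_ord_recr /=.
  by rewrite !qbin_small // !mulr0 !mul0r !addr0.
Qed.

End QBinomial.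
Arguments qbin : simpl never.

(** The usual factor [(1 + z x) (1 + x / z)] enters only through its cross term, as a three-term
    relation on the summands [T]. As this relation is linear in [T], the sum of the cases [z = w]
    and [z = w ^ (-1)], with [w] a cube root of unity, is covered without leaving integer
    coefficients. The offset [dl] is 0 for exponents like [j ^ 2] and 1 for exponents like
    [j (j + 1)]. *)
Lemma finite_triple_product (R : comNzRingType) (Q : R) (T : int -> R)
    (g : nat -> R) (dl : nat) :
  (forall (N i : nat) (j : int), (i <= 2 * N + dl)%N -> i%:Z = j + N%:Z + dl%:Z ->
     (g N - 1 - Q ^+ (2 * N + dl).+1) * T j =
     Q ^+ (2 * N + dl - i) * T (j + 1) + Q ^+ i * T (j - 1)) ->
  forall N : nat,
  (\sum_(i < dl.+1) qbin Q dl i * T (i%:Z - dl%:Z)) * \prod_(k < N) g k =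
  \sum_(i < (2 * N + dl).+1) qbin Q (2 * N + dl) i * T (i%:Z - N%:Z - dl%:Z).
Proof.
move=> gT; elim=> [|N IHN].
  by rewrite big_ord0 mulr1; apply: eq_bigr => i _; rewrite subr0.
rewrite (big_ord_recr N) mulrA IHN.
rewrite (_ : 2 * N.+1 + dl = (2 * N + dl).+2)%N; last by lia.
rewrite -(@qbin_step _ _ _ (g N) (fun i => T (i%:Z - N.+1%:Z - dl%:Z))).
  by congr (_ * _); apply: eq_bigr => i _; congr (_ * T _); lia.
move=> i iN; have := gT N i (i%:Z - N%:Z - dl%:Z) iN.
rewrite (_ : i.+1%:Z - N.+1%:Z - dl%:Z = i%:Z - N%:Z - dl%:Z); last by lia.
rewrite (_ : i.+2%:Z - N.+1%:Z - dl%:Z = i%:Z - N%:Z - dl%:Z + 1); last by lia.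
rewrite (_ : i%:Z - N.+1%:Z - dl%:Z = i%:Z - N%:Z - dl%:Z - 1); last by lia.
by apply; lia.
Qed.

Lemma conv1_eulerf d : (0 < d)%N -> conv1 (fun k => 1 - q ^+ (d * k.+1)).
Proof. by move=> d0; apply: conv1D => k; apply/eqm0N/eqmXn; nia. Qed.

(** Far from both ends of its row a Gaussian binomial tends to the inverse of [eulerf d]: the
    numerator in [qbin_prod] has only exponents above [m], and the denominator is a partial product
    of [eulerf d]. *)
Lemma eqm_qbin_eulerf d n i m : (0 < d)%N -> (m <= i)%N -> (m + i <= n)%N ->
  eqm m (qbin (q ^+ d) n i * eulerf d) 1.
Proof.
move=> d0 mi min.
apply: (@eqm_trans _ _ (qbin (q ^+ d) n i * \prod_(k < i) (1 - (q ^+ d) ^+ k.+1))).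
  apply: eqmM; first exact: eqm_refl.
  rewrite eulerfE; under [X in eqm _ _ X]eq_bigr => k _ do rewrite -exprM.
  exact: iprod_eqm (conv1_eulerf d0) mi.
rewrite qbin_prod; last by lia.
apply: eqm_prod1 => k _; rewrite -exprM -[X in eqm _ _ X]subr0.
apply: eqmD; first exact: eqm_refl.
by apply/eqmN/eqmXn; move: (ltn_ord k); nia.
Qed.

Definition qmono (e c : int -> int) (j : int) : fps int :=
  (c j)%:~R * q ^+ `|e j|%N.

Lemma fcoefZ (c : int) (f : fps int) n : (c%:~R * f) n = c * f n.
Proof.
rewrite mulrzl; case: c => c.
  rewrite -pmulrn; elim: c => [|c IHc]; first by rewrite mulr0n mul0r.
  by rewrite mulrS fcoefD IHc -[in RHS]natz -[c.+1]addn1 natrD natz mulrDl mul1r addrC.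
rewrite NegzE mulrNz fcoefN -pmulrn mulNr; congr (- _).
elim: c => [|c IHc]; first by rewrite mulr1n mul1r.
by rewrite mulrS fcoefD IHc -[in RHS]natz -[c.+2]addn1 natrD natz mulrDl mul1r addrC.
Qed.

Lemma fcoefXn k n : (q ^+ k) n = (n == k)%:R.
Proof.
rewrite -[q ^+ k]mulr1 fcoefXM fcoef1; case: leqP => kn.
  by congr (_%:R); apply/eqP/eqP; lia.
by rewrite (ltn_eqF kn).
Qed.

Lemma triple_product (d dl : nat) (e c : int -> int) (g : nat -> fps int) :
  (0 < d)%N -> conv1 g ->
  (forall j, 0 <= e j) -> (forall j : int, `|j| <= e j + 1) ->
  (forall (N i : nat) (j : int), (i <= 2 * N + dl)%N -> i%:Z = j + N%:Z + dl%:Z ->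
     (g N - 1 - q ^+ (d * (2 * N + dl).+1)) * qmono e c j =
     q ^+ (d * (2 * N + dl - i)) * qmono e c (j + 1)
     + q ^+ (d * i) * qmono e c (j - 1)) ->
  (\sum_(i < dl.+1) qbin (q ^+ d) dl i * qmono e c (i%:Z - dl%:Z)) * iprod g
    * eulerf d = qser e c.
Proof.
move=> d0 cg e0 ej gT; apply: fpsP => n.
(* If [e j <= n] then [|j| <= n + 1], and this [N] is just large enough for the row index
   [i = j + N + dl] to lie at distance at least [n] from both ends of the row [2 * N + dl]. *)
set N := (2 * n).+1.
have fin := @finite_triple_product _ (q ^+ d) (qmono e c) g dl.
have {fin}fin := fin _ N; rewrite -mulrA.
transitivity (((\sum_(i < dl.+1) qbin (q ^+ d) dl i * qmono e c (i%:Z - dl%:Z))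
    * ((\prod_(k < N) g k) * eulerf d)) n).
  have h : eqm n (iprod g) (\prod_(k < N) g k) by apply: iprod_eqm => //; lia.
  exact: (eqmM (eqm_refl _) (eqmM h (@eqm_refl n _))).
rewrite mulrA fin; last first.
  by move=> M i j iM ij; rewrite -!exprM; apply: gT.
rewrite mulr_suml.
transitivity ((\sum_(i < (2 * N + dl).+1) qmono e c (i%:Z - N%:Z - dl%:Z)) n).
  apply: (@eqm_sum n) => // i _; set j := _ - _.
  (* Terms of exponent at most [n] have a central binomial, which [eulerf d] cancels modulo
     [q ^+ n.+1]; the other terms vanish modulo that power by themselves. *)
  case: (lerP (e j) n%:Z) => ejn.
    rewrite mulrAC -[X in eqm _ _ X]mul1r; apply: eqmM (eqm_refl _).
    have jE : j = i%:Z - N%:Z - dl%:Z by [].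
    have NE : N = (2 * n).+1 by [].
    have := ej j; have := ltn_ord i; move: (nat_of_ord i) jE => k jE ki jn.
    by apply: eqm_qbin_eulerf => //; clearbody j N; lia.
  have m0 : eqm n (qmono e c j) 0.
    by rewrite /qmono; apply: eqmMXn; lia.
  have h := eqmM (eqmM (@eqm_refl n (qbin (q ^+ d) (2 * N + dl) i)) m0)
                 (@eqm_refl n (eulerf d)).
  by move=> m mn; rewrite h // m0 // mulr0 mul0r.
rewrite fcoef_sum.
rewrite (@qserE _ _ _ [seq i%:Z - N%:Z - dl%:Z | i <- index_iota 0 (2 * N + dl).+1]).
  rewrite big_map [RHS]big_mkcond [RHS]big_mkord.
  apply: eq_bigr => i _; rewrite fcoefZ fcoefXn; set j := _ - _.
  have -> : (n == `|e j|%N) = (e j == n%:Z) by have := e0 j; lia.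
  by case: eqP; rewrite ?mulr1 ?mulr0.
- by rewrite map_inj_uniq ?iota_uniq // => x y; lia.
- move=> j ejn; apply/mapP; exists (absz (j + N%:Z + dl%:Z)); have := ej j; rewrite /N.
    by rewrite mem_index_iota; lia.
  by lia.
Qed.

(** * Theta series *)

(** For a quadratic exponent [e], the power [q ^+ e j] factors out of the three-term relation, and
    what remains depends on [j] only through the weights [c]. *)
Lemma theta_product (d dl A B : nat) (e c : int -> int) (g : nat -> fps int) :
  (0 < d)%N -> conv1 g -> (A + B = d * dl.+1)%N ->
  (forall j, 0 <= e j) -> (forall j : int, `|j| <= e j + 1) ->
  (forall j : int, e (j + 1) = e j + d%:Z * j + A%:Z) ->
  (forall N j, (g N - 1 - q ^+ (d * (2 * N + dl).+1)) * (c j)%:~R =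
     q ^+ (d * N) * ((c (j + 1))%:~R * q ^+ A + (c (j - 1))%:~R * q ^+ B)) ->
  (\sum_(i < dl.+1) qbin (q ^+ d) dl i * qmono e c (i%:Z - dl%:Z)) * iprod g
    * eulerf d = qser e c.
Proof.
move=> d0 cg AB e0 ej eS gc; apply: triple_product => // N i j iN ij.
rewrite /qmono mulrA gc.
have eP := eS (j - 1); rewrite subrK in eP.
have := congr1 (fun x => d%:Z * x) ij; have := e0 j; have := e0 (j + 1).
have := e0 (j - 1); have := eS j => E1 E2 E3 E4 E5.
have dd : (d * (2 * N + dl - i) + d * i = d * (2 * N + dl))%N.
  by rewrite -mulnDr subnK.
have X1 : (d * (2 * N + dl - i) + `|e (j + 1)%R| = d * N + A + `|e j|)%N by lia.
have X2 : (d * i + `|e (j - 1)%R| = d * N + B + `|e j|)%N by lia.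
rewrite mulrCA -exprD X1 [q ^+ (d * i) * _]mulrCA -exprD X2 !exprD; ring.
Qed.

(* [w ^ m + w ^ (- m)] for a primitive cube root of unity [w]. *)
Definition chi3 (m : int) : int := if (3 %| m)%Z then 2 else -1.

(** The multiplier is [w + w ^ (-1) = -1]. *)
Lemma chi3_rec j : chi3 (j + 1) + chi3 (j - 1) = - chi3 j.
Proof. by rewrite /chi3; do 3 case: ifP; lia. Qed.

Lemma chi3_eq i j : ((i - j) %% 3 = 0 \/ (i + j) %% 3 = 0)%Z -> chi3 i = chi3 j.
Proof. by rewrite /chi3; do 2 case: ifP; lia. Qed.

(** In Ramanujan's notation [phiq d] is phi(q^d), and [psiq d] is 2 psi(q^(2d)) because [j] runs
    over all integers. The weight in [psi3q] is taken at the odd number [2 * j + 1], whose square is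
    [4 * (j * (j + 1)) + 1]. *)
Definition phiq d := qser (fun j => d%:Z * (j * j)) (fun=> 1).
Definition psiq d := qser (fun j => d%:Z * (j * (j + 1))) (fun=> 1).
Definition phi3q d := qser (fun j => d%:Z * (j * j)) chi3.
Definition psi3q d := qser (fun j => d%:Z * (j * (j + 1))) (fun j => chi3 (2 * j + 1)).

Definition altz (j : int) : int := if (2 %| j)%Z then 1 else -1.
Definition pent (j : int) : int := ((3 * (j * j) - j) %/ 2)%Z.

Lemma pentE j : 2 * pent j = 3 * (j * j) - j.
Proof.
have [k [->|->]] : exists k, j = 2 * k \/ j = 2 * k + 1 by exists (j %/ 2)%Z; lia.
  by rewrite /pent; lia.
by rewrite /pent; lia.
Qed.

Lemma pent_ge j : 0 <= pent j /\ `|j| <= pent j + 1.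
Proof.
have := pentE j; (have [?|?] : 1 <= j \/ j <= 0 by lia) => E.
  have : 0 <= 3 * (j * j) - j - 2 * j + 2 by nia.
  by lia.
have : 0 <= 3 * (j * j) + j by nia.
by lia.
Qed.

Lemma conv1_addX a : (forall k, k < a k)%N -> conv1 (fun k => 1 + q ^+ a k).
Proof. by move=> ka; apply: conv1D => k; apply: eqmXn. Qed.

Lemma conv1_subX a : (forall k, k < a k)%N -> conv1 (fun k => 1 - q ^+ a k).
Proof. by move=> ka; apply: conv1D => k; apply/eqm0N/eqmXn. Qed.

Lemma conv1_subaddX a b : (forall k, k < a k)%N -> (forall k, k < b k)%N ->
  conv1 (fun k => 1 - q ^+ a k + q ^+ b k).
Proof.
move=> ka kb k; rewrite -addrA.
apply: (conv1D (g := fun k => - q ^+ a k + q ^+ b k)) => {}k.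
by apply: eqm0D; [apply: eqm0N|]; apply: eqmXn.
Qed.

Lemma qmono0 e c j : e j = 0 -> qmono e c j = (c j)%:~R.
Proof. by move=> ej; rewrite /qmono ej mulr1. Qed.

Lemma theta_base1 (Q : fps int) (T : int -> fps int) :
  \sum_(i < 2) qbin Q 1 i * T (i%:Z - 1%:Z) = T (- 1) + T 0.
Proof.
rewrite !big_ord_recr big_ord0 add0r /= qbinn0 qbin_nn !mul1r.
by rewrite add0r subrr.
Qed.

(** With [x = q ^+ (d * (2 * k).+1)] the factor is [(1 + w x) (1 + w ^ (-1) x) = 1 - x + x ^ 2]. The
    leading 2 is [chi3 0]. *)
Lemma phi3q_prod d : (0 < d)%N ->
  phi3q d = 2 * iprod (fun k => 1 - q ^+ (d * (2 * k).+1) + q ^+ (2 * d * (2 * k).+1))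
    * eulerf (2 * d).
Proof.
move=> d0; rewrite /phi3q -(@theta_product (2 * d) 0 d d _ _
  (fun k => 1 - q ^+ (d * (2 * k).+1) + q ^+ (2 * d * (2 * k).+1))).
- by rewrite big_ord1 qbinn0 mul1r subr0 qmono0 //=; lia.
- by lia.
- by apply: conv1_subaddX => k; nia.
- by lia.
- by move=> j; nia.
- by move=> j; nia.
- by move=> j; lia.
- move=> N j; rewrite -mulrDl -intrD chi3_rec addn0.
  rewrite (_ : d * (2 * N).+1 = 2 * d * N + d)%N; last by lia.
  by rewrite exprD mulrNz; ring.
Qed.

(** Same factors [1 - x + x ^ 2], now with offset 1: the initial row consists of the terms [j = -1]
    and [j = 0], each of weight -1, whence the leading -2. *)
Lemma psi3q_prod d : (0 < d)%N ->
  psi3q d = - 2 * iprod (fun k => 1 - q ^+ (2 * d * k.+1) + q ^+ (2 * d * (2 * k.+1)))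
    * eulerf (2 * d).
Proof.
move=> d0; rewrite /psi3q -(@theta_product (2 * d) 1 (2 * d) (2 * d) _ _
  (fun k => 1 - q ^+ (2 * d * k.+1) + q ^+ (2 * d * (2 * k.+1)))).
- rewrite (@theta_base1 _ (qmono _ _)) !qmono0 ?mulr0 ?mulNr //.
  rewrite (_ : chi3 (2 * -1 + 1) = -1) // (_ : chi3 (0 + 1) = -1) //; ring.
- by lia.
- by apply: conv1_subaddX => k; nia.
- by lia.
- by move=> j; (have [?|?] : 0 <= j \/ j <= -1 by lia); nia.
- by move=> j; (have [?|?] : 0 <= j \/ j <= -1 by lia); nia.
- by move=> j; lia.
- move=> N j; rewrite -mulrDl -intrD.
  have -> : chi3 (2 * (j + 1) + 1) + chi3 (2 * (j - 1) + 1) = - chi3 (2 * j + 1).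
    rewrite -chi3_rec addrC; congr (_ + _); apply: chi3_eq; lia.
  rewrite (_ : 2 * d * N.+1 = 2 * d * N + 2 * d)%N; last by lia.
  rewrite (_ : 2 * d * (2 * N.+1) = 2 * d * (2 * N + 1).+1)%N; last by lia.
  by rewrite exprD mulrNz; ring.
Qed.

Lemma altzS j : altz (j + 1) = - altz j.
Proof. by rewrite /altz; do 2 case: ifP; lia. Qed.

(** The triple product supplies the factors of index 1 and 2 modulo 3, and [eulerf (3 * d)] those of
    index divisible by 3. *)
Lemma pentagonal d : (0 < d)%N -> eulerf d = qser (fun j => d%:Z * pent j) altz.
Proof.
move=> d0; rewrite -(@theta_product (3 * d) 0 d (2 * d) _ _
  (fun k => (1 - q ^+ (d * (3 * k).+1)) * (1 - q ^+ (d * (3 * k).+2)))).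
- rewrite big_ord1 qbinn0 mul1r subr0 qmono0; last by rewrite /pent /=; lia.
  rewrite mul1r !eulerfE.
  rewrite (@iprod_block _ 3) //; last exact: conv1_eulerf.
  rewrite iprodM.
  + apply: eq_iprod => k; rewrite !big_ord_recl big_ord0 mulr1 /= !mulrA.
    by rewrite !addn0 /bump /= !add1n !addn1 addn2 ; congr (_ * (1 - q ^+ _)); lia.
  + by apply: conv1M; apply: conv1_subX => k; nia.
  + by apply: conv1_eulerf; lia.
- by lia.
- by apply: conv1M; apply: conv1_subX => k; nia.
- by lia.
- by move=> j; have [? ?] := pent_ge j; nia.
- by move=> j; have [? ?] := pent_ge j; nia.
- move=> j; have -> : pent (j + 1) = pent j + 3 * j + 1.
    by have := pentE j; have := pentE (j + 1); lia.
  by lia.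
- move=> N j; have := altzS (j - 1); rewrite subrK altzS => ->; rewrite opprK !mulrNz.
  rewrite (_ : d * (3 * N).+1 = 3 * d * N + d)%N; last by lia.
  rewrite (_ : d * (3 * N).+2 = 3 * d * N + 2 * d)%N; last by lia.
  rewrite (_ : 3 * d * (2 * N + 0).+1 = 3 * d * N + d + (3 * d * N + 2 * d))%N; last by lia.
  by rewrite !exprD; ring.
Qed.

(** These are the companions of [phiq] and [psiq] in the square of the pentagonal number series, see
    [eulerf_sqr]. *)
Definition theta1 d := qser (fun j => d%:Z * (3 * (j * j) - j)) (fun=> 1).
Definition theta2 d := qser (fun j => d%:Z * (3 * (j * j) + 2 * j)) (fun=> 1).

Lemma theta1_prod d : (0 < d)%N ->
  theta1 d = iprod (fun k => (1 + q ^+ (2 * d * (3 * k).+1)) * (1 + q ^+ (2 * d * (3 * k).+2)))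
    * eulerf (6 * d).
Proof.
move=> d0; rewrite /theta1 -(@theta_product (6 * d) 0 (2 * d) (4 * d) _ _
  (fun k => (1 + q ^+ (2 * d * (3 * k).+1)) * (1 + q ^+ (2 * d * (3 * k).+2)))).
- by rewrite big_ord1 qbinn0 mul1r subr0 qmono0 ?mul1r //=; lia.
- by lia.
- by apply: conv1M; apply: conv1_addX => k; nia.
- by lia.
- by move=> j; (have [?|?] : 1 <= j \/ j <= 0 by lia); nia.
- by move=> j; (have [?|?] : 1 <= j \/ j <= 0 by lia); nia.
- by move=> j; lia.
- move=> N j.
  rewrite (_ : 2 * d * (3 * N).+1 = 6 * d * N + 2 * d)%N; last by lia.
  rewrite (_ : 2 * d * (3 * N).+2 = 6 * d * N + 4 * d)%N; last by lia.
  rewrite (_ : 6 * d * (2 * N + 0).+1 = 6 * d * N + 2 * d + (6 * d * N + 4 * d))%N; last by lia.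
  by rewrite !exprD; ring.
Qed.

Lemma theta2_prod d : (0 < d)%N ->
  theta2 d = iprod (fun k => (1 + q ^+ (d * (6 * k).+1)) * (1 + q ^+ (d * (6 * k + 5))))
    * eulerf (6 * d).
Proof.
move=> d0; rewrite /theta2 -(@theta_product (6 * d) 0 (5 * d) d _ _
  (fun k => (1 + q ^+ (d * (6 * k).+1)) * (1 + q ^+ (d * (6 * k + 5))))).
- by rewrite big_ord1 qbinn0 mul1r subr0 qmono0 ?mul1r //=; lia.
- by lia.
- by apply: conv1M; apply: conv1_addX => k; nia.
- by lia.
- by move=> j; (have [?|?] : 0 <= j \/ j <= -1 by lia); nia.
- by move=> j; (have [?|?] : 0 <= j \/ j <= -1 by lia); nia.
- by move=> j; lia.
- move=> N j.
  rewrite (_ : d * (6 * N).+1 = 6 * d * N + d)%N; last by lia.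
  rewrite (_ : d * (6 * N + 5) = 6 * d * N + 5 * d)%N; last by lia.
  rewrite (_ : 6 * d * (2 * N + 0).+1 = 6 * d * N + d + (6 * d * N + 5 * d))%N; last by lia.
  by rewrite !exprD; ring.
Qed.

(** * Evaluation of the theta series as eta quotients *)

(** The products (-q^d; q^d)_oo and (-q^d; q^(2d))_oo. *)
Definition plusf d := iprod (fun k => 1 + q ^+ (d * k.+1)).
Definition oddplusf d := iprod (fun k => 1 + q ^+ (d * (2 * k).+1)).

Lemma plusfE d : (0 < d)%N -> plusf d * eulerf d = eulerf (2 * d).
Proof.
move=> d0; rewrite !eulerfE iprodM; last exact: conv1_eulerf.
  apply: eq_iprod => k; rewrite (_ : 2 * d * k.+1 = d * k.+1 * 2)%N; last by lia.
  by rewrite (exprM q (d * k.+1) 2); move: (q ^+ (d * k.+1)) => x; ring.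
by apply: conv1_addX => k; nia.
Qed.

Lemma eulerf_odd d : (0 < d)%N ->
  eulerf d = iprod (fun k => 1 - q ^+ (d * (2 * k).+1)) * eulerf (2 * d).
Proof.
move=> d0; rewrite !eulerfE (@iprod_block _ 2) //; last exact: conv1_eulerf.
rewrite iprodM; first last.
- by apply: conv1_eulerf; lia.
- by apply: conv1_subX => k; nia.
apply: eq_iprod => k; rewrite !big_ord_recl big_ord0 mulr1 lift0 addn0 addn1.
by congr (_ * (1 - q ^+ _)); lia.
Qed.

Lemma oddplusfE d : (0 < d)%N ->
  oddplusf d * eulerf d * eulerf (4 * d) = eulerf (2 * d) ^+ 2.
Proof.
move=> d0; rewrite (eulerf_odd d0) expr2 {2}(@eulerf_odd (2 * d)); last by lia.
rewrite (_ : 2 * (2 * d) = 4 * d)%N; last by lia.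
have <- : oddplusf d * iprod (fun k => 1 - q ^+ (d * (2 * k).+1)) =
    iprod (fun k => 1 - q ^+ (2 * d * (2 * k).+1)).
  rewrite iprodM; first last.
  - by apply: conv1_subX => k; nia.
  - by apply: conv1_addX => k; nia.
  apply: eq_iprod => k; rewrite (_ : 2 * d * (2 * k).+1 = d * (2 * k).+1 * 2)%N; last by lia.
  by rewrite (exprM q (d * (2 * k).+1) 2); move: (q ^+ (d * (2 * k).+1)) => x; ring.
ring.
Qed.

(** The product in [theta1_prod] runs over indices prime to 3, so it is the quotient of
    [plusf (2 * d)] by [plusf (6 * d)]. Like the evaluations that follow, the identity is stated
    with denominators cleared. *)
Lemma theta1E d : (0 < d)%N ->
  theta1 d * eulerf (12 * d) * eulerf (2 * d) = eulerf (4 * d) * eulerf (6 * d) ^+ 2.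
Proof.
move=> d0; have P2 : plusf (2 * d) * eulerf (2 * d) = eulerf (2 * (2 * d)).
  by apply: plusfE; lia.
have P6 : plusf (6 * d) * eulerf (6 * d) = eulerf (2 * (6 * d)) by apply: plusfE; lia.
rewrite !mulnA /= in P2 P6; rewrite theta1_prod // -P6 -P2.
have <- : iprod (fun k => (1 + q ^+ (2 * d * (3 * k).+1)) * (1 + q ^+ (2 * d * (3 * k).+2)))
   * plusf (6 * d) = plusf (2 * d).
  rewrite /plusf [RHS](@iprod_block _ 3) //; last by apply: conv1_addX => k; nia.
  rewrite iprodM; first last.
  - by apply: conv1_addX => k; nia.
  - by apply: conv1M; apply: conv1_addX => k; nia.
  apply: eq_iprod => k; rewrite !big_ord_recl big_ord0 mulr1 !lift0 addn0 addn1 addn2 mulrA.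
  by congr (_ * (1 + q ^+ _)); lia.
ring.
Qed.

(** Here the indices are odd and prime to 3, so the product is the quotient of [oddplusf d] by
    [oddplusf (3 * d)]. *)
Lemma theta2E d : (0 < d)%N ->
  theta2 d * eulerf (6 * d) * eulerf d * eulerf (4 * d) =
  eulerf (2 * d) ^+ 2 * eulerf (3 * d) * eulerf (12 * d).
Proof.
move=> d0; have O1 := oddplusfE d0.
have O3 : oddplusf (3 * d) * eulerf (3 * d) * eulerf (4 * (3 * d)) = eulerf (2 * (3 * d)) ^+ 2.
  by apply: oddplusfE; lia.
rewrite !mulnA /= in O3; apply: (mulIr (eulerf_unit (6 * d))).
transitivity (theta2 d * eulerf d * eulerf (4 * d) * eulerf (6 * d) ^+ 2); first by ring.
rewrite -O3 -O1 theta2_prod //.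
have <- : iprod (fun k => (1 + q ^+ (d * (6 * k).+1)) * (1 + q ^+ (d * (6 * k + 5))))
   * oddplusf (3 * d) = oddplusf d.
  rewrite /oddplusf [RHS](@iprod_block _ 3) //; last by apply: conv1_addX => k; nia.
  rewrite iprodM; first last.
  - by apply: conv1_addX => k; nia.
  - by apply: conv1M; apply: conv1_addX => k; nia.
  apply: eq_iprod => k; rewrite !big_ord_recl big_ord0 mulr1 !lift0 addn0 addn1 addn2.
  rewrite mulrAC -mulrA.
  by congr ((1 + q ^+ _) * ((1 + q ^+ _) * (1 + q ^+ _))); lia.
ring.
Qed.

(** By [(1 - x + x ^ 2) (1 + x) = 1 + x ^ 3] the product is the quotient of [oddplusf (3 * d)] by
    [oddplusf d]; [psi3qE] uses the same identity with [plusf]. *)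
Lemma phi3qE d : (0 < d)%N ->
  phi3q d * eulerf (2 * d) * eulerf (3 * d) * eulerf (12 * d) =
  2 * eulerf d * eulerf (4 * d) * eulerf (6 * d) ^+ 2.
Proof.
move=> d0; have O1 := oddplusfE d0.
have O3 : oddplusf (3 * d) * eulerf (3 * d) * eulerf (4 * (3 * d)) = eulerf (2 * (3 * d)) ^+ 2.
  by apply: oddplusfE; lia.
rewrite !mulnA /= in O3; apply: (mulIr (eulerf_unit (2 * d))).
transitivity (phi3q d * eulerf (3 * d) * eulerf (12 * d) * eulerf (2 * d) ^+ 2); first by ring.
rewrite -O3 -O1 phi3q_prod //.
have <- : iprod (fun k => 1 - q ^+ (d * (2 * k).+1) + q ^+ (2 * d * (2 * k).+1))
   * oddplusf d = oddplusf (3 * d).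
  rewrite iprodM; first last.
  - by apply: conv1_addX => k; nia.
  - by apply: conv1_subaddX => k; nia.
  apply: eq_iprod => k.
  rewrite (_ : 2 * d * (2 * k).+1 = d * (2 * k).+1 * 2)%N; last by lia.
  rewrite (_ : 3 * d * (2 * k).+1 = d * (2 * k).+1 * 3)%N; last by lia.
  by rewrite !(exprM q (d * (2 * k).+1)); move: (q ^+ (d * (2 * k).+1)) => x; ring.
ring.
Qed.

Lemma psi3qE d : (0 < d)%N ->
  psi3q d * eulerf (4 * d) * eulerf (6 * d) =
  - 2 * eulerf (2 * d) ^+ 2 * eulerf (12 * d).
Proof.
move=> d0; have P2 : plusf (2 * d) * eulerf (2 * d) = eulerf (2 * (2 * d)).
  by apply: plusfE; lia.
have P6 : plusf (6 * d) * eulerf (6 * d) = eulerf (2 * (6 * d)) by apply: plusfE; lia.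
rewrite !mulnA /= in P2 P6; rewrite psi3q_prod // -P6 -P2.
have <- : iprod (fun k => 1 - q ^+ (2 * d * k.+1) + q ^+ (2 * d * (2 * k.+1)))
   * plusf (2 * d) = plusf (6 * d).
  rewrite iprodM; first last.
  - by apply: conv1_addX => k; nia.
  - by apply: conv1_subaddX => k; nia.
  apply: eq_iprod => k.
  rewrite (_ : 2 * d * (2 * k.+1) = 2 * d * k.+1 * 2)%N; last by lia.
  rewrite (_ : 6 * d * k.+1 = 2 * d * k.+1 * 3)%N; last by lia.
  by rewrite !(exprM q (2 * d * k.+1)); move: (q ^+ (2 * d * k.+1)) => x; ring.
ring.
Qed.

(** * Double theta series *)

Lemma finfib_int (e : int -> int) : (forall j : int, `|j| <= e j + 1) -> finfib e.
Proof.
move=> ej n; pose s := [seq i%:Z - n.+1%:Z | i <- iota 0 (2 * n).+3].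
have sP (j : int) : e j = n%:Z -> j \in s.
  move=> ejn; apply/mapP; exists (absz (j + n.+1%:Z)); have := ej j.
    by rewrite mem_iota; lia.
  by lia.
exact: sub_finite_set sP (finite_seq s).
Qed.

Lemma finfib_pair (I J : choiceType) (e : I -> int) (e' : J -> int) :
  finfib e -> finfib e' -> (forall i, 0 <= e i) -> (forall j, 0 <= e' j) ->
  finfib (fun p : I * J => e p.1 + e' p.2).
Proof.
move=> fe fe' e0 e0' n.
have [s _ sP] := finfib_cover n fe e0.
have [t _ tP] := finfib_cover n fe' e0'.
pose st := [seq (i, j) | i <- s, j <- t].
have stP (p : I * J) : e p.1 + e' p.2 = n%:Z -> p \in st.
  case: p => i j /= eij; apply/allpairsP; exists (i, j); split => //=.
    by apply: sP; move: (e0' j); lia.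
  by apply: tP; move: (e0 i); lia.
exact: sub_finite_set stP (finite_seq st).
Qed.

Lemma square_ge (d : nat) (j : int) : (0 < d)%N ->
  0 <= d%:Z * (j * j) /\ `|j| <= d%:Z * (j * j) + 1.
Proof. by move=> d0; split; nia. Qed.

Lemma pronic_ge (d : nat) (j : int) : (0 < d)%N ->
  0 <= d%:Z * (j * (j + 1)) /\ `|j| <= d%:Z * (j * (j + 1)) + 1.
Proof. by move=> d0; (have [?|?] : 0 <= j \/ j <= -1 by lia); split; nia. Qed.

Lemma scale_ge (d : nat) (j x : int) : (0 < d)%N ->
  0 <= x /\ `|j| <= x + 1 -> 0 <= d%:Z * x /\ `|j| <= d%:Z * x + 1.
Proof. by move=> d0 [x0 jx]; split; nia. Qed.

Lemma theta1_ge (j : int) : 0 <= 3 * (j * j) - j /\ `|j| <= 3 * (j * j) - j + 1.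
Proof. by (have [?|?] : 1 <= j \/ j <= 0 by lia); split; nia. Qed.

Lemma theta2_ge (j : int) : 0 <= 3 * (j * j) + 2 * j /\ `|j| <= 3 * (j * j) + 2 * j + 1.
Proof. by (have [?|?] : 0 <= j \/ j <= -1 by lia); split; nia. Qed.

Lemma qser_intM (e w e' w' : int -> int) :
  (forall j : int, 0 <= e j /\ `|j| <= e j + 1) ->
  (forall j : int, 0 <= e' j /\ `|j| <= e' j + 1) ->
  qser e w * qser e' w' =
  qser (fun p : int * int => e p.1 + e' p.2) (fun p => w p.1 * w' p.2).
Proof.
move=> ej ej'; apply: qserM => [||j|j]; [apply: finfib_int => j; exact: (ej j).2|
  apply: finfib_int => j; exact: (ej' j).2|exact: (ej j).1|exact: (ej' j).1].
Qed.

Lemma finfib_intM (e e' : int -> int) :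
  (forall j : int, 0 <= e j /\ `|j| <= e j + 1) ->
  (forall j : int, 0 <= e' j /\ `|j| <= e' j + 1) ->
  finfib (fun p : int * int => e p.1 + e' p.2).
Proof.
move=> ej ej'; apply: finfib_pair => [||j|j]; [apply: finfib_int => j; exact: (ej j).2|
  apply: finfib_int => j; exact: (ej' j).2|exact: (ej j).1|exact: (ej' j).1].
Qed.

Lemma qser_diag_split (e w : int * int -> int) : finfib e ->
  qser e w = qser (fun p => e (p.1 + p.2, p.1 - p.2)) (fun p => w (p.1 + p.2, p.1 - p.2))
    + qser (fun p => e (p.1 + 1 + p.2, p.1 - p.2)) (fun p => w (p.1 + 1 + p.2, p.1 - p.2)).
Proof.
move=> fe.
apply: (qser_split (h := fun p : int * int => (p.1 + p.2, p.1 - p.2))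
                   (g := fun p : int * int => (p.1 + 1 + p.2, p.1 - p.2))) => //.
- by case=> a b [c d] /= [h1 h2]; congr (_, _); lia.
- by case=> a b [c d] /= [h1 h2]; congr (_, _); lia.
- by case=> a b [c d] /= [h1 h2]; lia.
case=> a b; have [h|h] : ((a + b) %% 2 = 0)%Z \/ ((a + b) %% 2 = 1)%Z by lia.
  by left; exists (((a + b) %/ 2)%Z, ((a - b) %/ 2)%Z) => /=; congr (_, _); lia.
by right; exists (((a + b) %/ 2)%Z, ((a - b) %/ 2)%Z) => /=; congr (_, _); lia.
Qed.

(** In the coordinates of [qser_diag_split] the two pentagonal exponents decouple: [pent (k + t) +
    pent (k - t) = 3 k ^ 2 - k + 3 t ^ 2]. The sign [altz] of a pair depends only on the parity of
    the sum of its entries, so it is constant on each of the two classes. *)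
Lemma eulerf_sqr d : (0 < d)%N ->
  eulerf d ^+ 2 = theta1 d * phiq (3 * d) - q ^+ d * (theta2 d * psiq (3 * d)).
Proof.
move=> d0; rewrite expr2 pentagonal //.
have pge j : 0 <= d%:Z * pent j /\ `|j| <= d%:Z * pent j + 1.
  exact: (scale_ge d0 (pent_ge j)).
have d30 : (0 < 3 * d)%N by lia.
rewrite qser_intM // qser_diag_split; last exact: (finfib_intM pge pge).
rewrite /theta1 /phiq qser_intM; first last.
- by move=> j; apply: square_ge.
- by move=> j; apply: (scale_ge d0 (theta1_ge j)).
rewrite /theta2 /psiq qser_intM; first last.
- by move=> j; apply: pronic_ge.
- by move=> j; apply: (scale_ge d0 (theta2_ge j)).
rewrite qserXM; last first.
  case=> i j /=; have [h1 _] := pronic_ge j d30.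
  by have [h2 _] := scale_ge d0 (theta2_ge i); lia.
rewrite -qserN; congr (_ + _); apply: eq_qser => -[k t] /=.
- have -> : pent (k + t) = 3 * (k * k) - k + 3 * (t * t) - pent (k - t).
    by have := pentE (k + t); have := pentE (k - t); lia.
  by lia.
- by rewrite /altz; do 2 case: ifP; lia.
- have -> : pent (k + 1 + t) =
      3 * (k * k) + 2 * k + 1 + 3 * (t * (t + 1)) - pent (k - t).
    by have := pentE (k + 1 + t); have := pentE (k - t); lia.
  by lia.
- by rewrite /altz; do 2 case: ifP; lia.
Qed.

(* Multiplication by a cube root of unity permutes the three nonzero classes
   of the Eisenstein integers modulo 2. *)
Lemma eisenstein_rotation :
  psi3q 1 * psiq 3 = 2 * (psi3q 4 * phiq 12 + q ^+ 2 * (phi3q 4 * psiq 12)).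
Proof.
rewrite /psi3q /psiq /phi3q /phiq.
rewrite !qser_intM; try by move=> j; (apply: pronic_ge || apply: square_ge).
rewrite qserXM; last first.
  case=> i j /=; have [h1 _] := @pronic_ge 12 j isT.
  by have [h2 _] := @square_ge 4 i isT; lia.
rewrite qser_diag_split; last first.
  exact: (finfib_intM (fun j => @pronic_ge 1 j isT) (fun j => @pronic_ge 3 j isT)).
set S0 := qser _ _; set S1 := qser _ _; set T0 := qser _ _; set T1 := qser _ _.
(* The two classes are complex conjugates: writing [(a, b)] for the original indices, the reindexing
   replaces [b] by [-1 - b], hence [2 b + 1] by its negative, and the weight depends on [a]
   alone. *)
have -> : S1 = S0.
  rewrite /S0 (reindex_qser (h := fun p : int * int => (p.2, p.1 + 1))); last first.
    by exists (fun p => (p.2 - 1, p.1)) => -[a b] /=; congr (_, _); lia.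
  by apply: eq_qser => -[a b] /=; [lia | congr (chi3 _ * _); lia].
(* Set [2 a + 1 = M + 3 N] and [2 b + 1 = M - N], which is multiplication by a unit up to
   conjugation, so the norm is [M ^ 2 + 3 N ^ 2]. According to the parity of the second summation
   variable, [(M, N)] is [(2 u + 1, 2 v)], giving [T0], or [(2 u, 2 v + 1)], giving [T1]. *)
suff -> : S0 = T0 + T1 by ring.
rewrite /S0 (qser_split (h := fun p : int * int => (p.1 + p.2, 2 * p.2))
                   (g := fun p : int * int => (p.1 + p.2, 2 * p.2 + 1))).
- congr (_ + _); apply: eq_qser => -[u v] /=.
  + by lia.
  + by congr (_ * _); apply: chi3_eq; lia.
  + by lia.
  + by congr (_ * _); apply: chi3_eq; lia.
- move=> n.
  have F := finfib_intM (fun j => @pronic_ge 1 j isT) (fun j => @pronic_ge 3 j isT) n.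
  have inj : injective (fun p : int * int => (p.1 + p.2, p.1 - p.2)).
    by case=> a b [c d] /= [h1 h2]; congr (_, _); lia.
  exact: (finite_preimage (fun x y _ _ => @inj x y) F).
- by case=> a b [c d] /= [h1 h2]; congr (_, _); lia.
- by case=> a b [c d] /= [h1 h2]; congr (_, _); lia.
- by case=> a b [c d] /= [h1 h2]; lia.
case=> a b; have [h|h] : (b %% 2 = 0)%Z \/ (b %% 2 = 1)%Z by lia.
  by left; exists (a - (b %/ 2)%Z, (b %/ 2)%Z) => /=; congr (_, _); lia.
by right; exists (a - (b %/ 2)%Z, (b %/ 2)%Z) => /=; congr (_, _); lia.
Qed.

Lemma qser_parity d (w : int -> int) : (0 < d)%N ->
  qser (fun j => d%:Z * (j * j)) w =
  qser (fun j => (4 * d)%:Z * (j * j)) (fun j => w (2 * j)) +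
  q ^+ d * qser (fun j => (4 * d)%:Z * (j * (j + 1))) (fun j => w (2 * j + 1)).
Proof.
move=> d0; rewrite qserXM; last first.
  by move=> j; apply: (@pronic_ge (4 * d) j _).1; lia.
rewrite (qser_split (h := fun j : int => 2 * j) (g := fun j : int => 2 * j + 1)).
- by congr (_ + _); apply: eq_qser => j //=; lia.
- by apply: finfib_int => j; apply: (square_ge j d0).2.
- by move=> i j; lia.
- by move=> i j; lia.
- by move=> i j; lia.
move=> i; have [h|h] : (i %% 2 = 0)%Z \/ (i %% 2 = 1)%Z by lia.
  by left; exists (i %/ 2)%Z; lia.
by right; exists (i %/ 2)%Z; lia.
Qed.

Lemma phiq_parity d : (0 < d)%N -> phiq d = phiq (4 * d) + q ^+ d * psiq (4 * d).
Proof. exact: qser_parity. Qed.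

Lemma phi3q_parity d : (0 < d)%N -> phi3q d = phi3q (4 * d) + q ^+ d * psi3q (4 * d).
Proof.
move=> d0; rewrite /phi3q qser_parity //; congr (_ + _); apply: eq_qser => // j.
by apply: chi3_eq; lia.
Qed.

(** * The 4-dissection and its signs *)

(** Multiply [eulerf_sqr] by [eulerf d]; comparing eta quotients turns [eulerf d * theta1 d] and
    [eulerf d * theta2 d] into the series weighted by [chi3]. The two summands on the right belong
    to Z[sqrt(-3)] and to its complement in Z[w]. *)
Lemma cubic_theta d : (0 < d)%N ->
  2 * eulerf d ^+ 3 =
  eulerf (3 * d) * (phi3q d * phiq (3 * d) + q ^+ d * (psi3q d * psiq (3 * d))).
Proof.
move=> d0; have T1 : phi3q d * eulerf (3 * d) = 2 * eulerf d * theta1 d.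
  apply: (mulIr (eulerf_unit (12 * d))); apply: (mulIr (eulerf_unit (2 * d))).
  transitivity (phi3q d * eulerf (2 * d) * eulerf (3 * d) * eulerf (12 * d)); first by ring.
  rewrite phi3qE // -[RHS]mulrA -[RHS]mulrA [theta1 d * _]mulrA theta1E //; ring.
have T2 : psi3q d * eulerf (3 * d) = - 2 * eulerf d * theta2 d.
  apply: (mulIr (eulerf_unit (4 * d))); apply: (mulIr (eulerf_unit (6 * d))).
  transitivity (psi3q d * eulerf (4 * d) * eulerf (6 * d) * eulerf (3 * d)); first by ring.
  transitivity (- 2 * (theta2 d * eulerf (6 * d) * eulerf d * eulerf (4 * d))); last by ring.
  by rewrite psi3qE // theta2E //; ring.
transitivity (2 * eulerf d * eulerf d ^+ 2); first by ring.
rewrite eulerf_sqr // mulrBr.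
transitivity ((phi3q d * eulerf (3 * d)) * phiq (3 * d)
  + q ^+ d * ((psi3q d * eulerf (3 * d)) * psiq (3 * d))); last by ring.
by rewrite T1 T2; ring.
Qed.

(** In the product of the two parity splittings, the even-even and odd-odd terms reassemble into
    [cubic_theta] for [d = 4]. The mixed terms occur once there and twice more through
    [eisenstein_rotation], whence the factor 3. *)
Lemma eulerf1_cube :
  2 * eulerf 1 ^+ 3 * eulerf 12 =
  eulerf 3 * (2 * eulerf 4 ^+ 3
    + 3 * eulerf 12 * (q * (psi3q 4 * phiq 12) + q ^+ 3 * (phi3q 4 * psiq 12))).
Proof.
have c4 := @cubic_theta 4 isT.
rewrite (@cubic_theta 1 isT) c4 eisenstein_rotation phi3q_parity // (@phiq_parity 3) //.
rewrite (_ : 3 * 4 = 12)%N // (_ : 4 * 1 = 4)%N // (_ : 3 * 1 = 3)%N //.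
by rewrite (_ : 4 * 3 = 12)%N //; ring.
Qed.

(** * Nonnegative and positive series in a power of q *)

Definition nonneg (d : nat) (f : fps int) :=
  forall n, 0 <= f n /\ (~~ (d %| n)%N -> f n = 0).

Definition nonneg_pos0 d f := nonneg d f /\ 0 < f 0%N.

Definition positive d f := nonneg d f /\ forall n, 0 < f (d * n)%N.

Lemma nonneg1 d : nonneg d 1.
Proof.
move=> n; rewrite fcoef1; split; first by case: eqP.
by case: eqP => // -> ; rewrite dvdn0.
Qed.

Lemma nonnegM d f g : nonneg d f -> nonneg d g -> nonneg d (f * g).
Proof.
move=> nf ng n; split.
  by apply: sumr_ge0 => i _; apply: mulr_ge0; [apply: (nf _).1 | apply: (ng _).1].
move=> dn; apply: big1 => i _; have [di|/(nf _).2 ->] := boolP (d %| i)%N; last first.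
  by rewrite mul0r.
rewrite (ng _).2 ?mulr0 //; apply: contra dn => dni.
by rewrite -(subnKC (_ : i <= n)%N) ?dvdn_addr // -ltnS.
Qed.

Lemma nonneg_sum d (I : Type) (r : seq I) (F : I -> fps int) :
  (forall i, nonneg d (F i)) -> nonneg d (\sum_(i <- r) F i).
Proof.
move=> nF n; rewrite fcoef_sum; split.
  by apply: sumr_ge0 => i _; apply: (nF i n).1.
by move=> dn; apply: big1 => i _; apply: (nF i n).2.
Qed.

Lemma nonneg_prod d (I : Type) (r : seq I) (F : I -> fps int) :
  (forall i, nonneg d (F i)) -> nonneg d (\prod_(i <- r) F i).
Proof.
by move=> nF; elim/big_ind: _ => //; [apply: nonneg1 | apply: nonnegM].
Qed.

Lemma nonneg_pos0M d f g :
  nonneg_pos0 d f -> nonneg_pos0 d g -> nonneg_pos0 d (f * g).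
Proof.
by move=> [nf f0] [ng g0]; split; [apply: nonnegM | rewrite fcoefM0 mulr_gt0].
Qed.

Lemma positiveM d f g : positive d f -> nonneg_pos0 d g -> positive d (f * g).
Proof.
move=> [nf fp] [ng g0]; split; first exact: nonnegM.
move=> n; rewrite fcoefM big_ord_recr /= subnn ltr_wpDl ?mulr_gt0 //.
by apply: sumr_ge0 => i _; apply: mulr_ge0; [apply: (nf _).1 | apply: (ng _).1].
Qed.

Lemma positive_nonneg_pos0 d f : positive d f -> nonneg_pos0 d f.
Proof. by case=> nf fp; split=> //; have := fp 0%N; rewrite muln0. Qed.

Lemma nonneg_iprod d g : (forall k, nonneg d (g k)) -> nonneg_pos0 d (iprod g).
Proof.
move=> ng; split; last by rewrite /= big_ord0.
by move=> n; apply: (nonneg_prod _ (fun i : 'I_n => ng i) n).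
Qed.

Lemma nonneg_Xn d a : (d %| a)%N -> nonneg d (q ^+ a).
Proof.
move=> da n; rewrite fcoefXn; split; first by case: eqP.
by case: eqP => // ->; rewrite da.
Qed.

Definition geom (a : nat) : fps int := FPS (fun n => (a %| n)%N%:R).

Lemma geomE a : (0 < a)%N -> (1 - q ^+ a) * geom a = 1.
Proof.
move=> a0; apply: fpsP => n; rewrite mulrBl mul1r fcoefB fcoefXM fcoef1 /=.
case: leqP => an.
  have -> : (n == 0)%N = false by lia.
  by rewrite -{1}(subnK an) dvdn_addl // subrr.
by rewrite subr0; case: n an => [|n] an; rewrite ?dvdn0 // gtnNdvd.
Qed.

Lemma conv1_geom a : (0 < a)%N -> conv1 (fun k => geom (a * k.+1)).
Proof.
move=> a0 k n nk; rewrite fcoef1 /=; case: n nk => [|n] nk; first by rewrite dvdn0.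
by rewrite gtnNdvd //; nia.
Qed.

Lemma eulerfV a : (0 < a)%N -> (eulerf a)^-1 = iprod (fun k => geom (a * k.+1)).
Proof.
move=> a0; apply: (mulrI (eulerf_unit a)); rewrite mulrV ?eulerf_unit //.
rewrite eulerfE iprodM; [|exact: conv1_eulerf|exact: conv1_geom].
apply: fpsP => n /=; rewrite big1 // => k _; apply: geomE; nia.
Qed.

Lemma nonneg_geom d a : (d %| a)%N -> nonneg d (geom a).
Proof.
move=> da n /=; split; first by case: (_ %| _)%N.
by move=> dn; case: (boolP (a %| n)%N) => // /(dvdn_trans da); rewrite (negPf dn).
Qed.

Lemma nonneg_eulerfV d a : (0 < a)%N -> (d %| a)%N -> nonneg_pos0 d (eulerf a)^-1.
Proof.
move=> a0 da; rewrite eulerfV //; apply: nonneg_iprod => k.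
exact/nonneg_geom/dvdn_mulr.
Qed.

Lemma positive_eulerfV d : (0 < d)%N -> positive d (eulerf d)^-1.
Proof.
move=> d0; split; first exact: (nonneg_eulerfV d0 (dvdnn d)).1.
(* Truncating at one factor more than necessary keeps the product nonempty even for [n = 0], so its
   first factor, the geometric series in [q ^+ d], can be split off; that factor alone is positive
   at every multiple of [d]. *)
move=> n; rewrite eulerfV // (iprod_eqm (conv1_geom d0) (leqnSn (d * n))) //.
rewrite big_ord_recl.
have gp : positive d (geom (d * 1)).
  split; first by apply: nonneg_geom; rewrite muln1.
  by move=> m /=; rewrite muln1 dvdn_mulr.
apply: (positiveM gp _).2; split.
  by apply: nonneg_prod => i; apply/nonneg_geom/dvdn_mulr.
elim/big_ind: _ => // [x y x0 y0 | i _]; first by rewrite fcoefM0 mulr_gt0.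
by rewrite /= dvdn0.
Qed.

(** Factor by factor, [(1 - x ^ m) / (1 - x)] is the polynomial [1 + x + ... + x ^ (m - 1)]. *)
Lemma nonneg_eulerf_ratio d m a : (0 < m)%N -> (0 < a)%N -> (d %| a)%N ->
  nonneg_pos0 d (eulerf (m * a) / eulerf a).
Proof.
move=> m0 a0 da.
have ca : conv1 (fun k => 1 - q ^+ (a * k.+1)) by apply: conv1_eulerf.
pose g k := \sum_(i < m) (q ^+ (a * k.+1)) ^+ i.
have cg : conv1 g.
  move: m0 @g; case: m => // m' _ g k; rewrite /g big_ord_recl expr0.
  apply: (conv1D (g := fun k => \sum_(i < m') (q ^+ (a * k.+1)) ^+ lift ord0 i)) => {}k.
  by apply: eqm_sum0 => i _; rewrite -exprM; apply: eqmXn; rewrite lift0; nia.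
have -> : eulerf (m * a) = iprod g * eulerf a.
  rewrite !eulerfE iprodM //; apply: eq_iprod => k.
  by rewrite -mulnA mulnC exprM mulrC -[RHS]opprK -mulNr opprB -subrX1 opprB.
rewrite mulrK ?eulerf_unit //; apply: nonneg_iprod => k; apply: nonneg_sum => i.
by rewrite -exprM -mulnA; apply/nonneg_Xn/dvdn_mulr.
Qed.

Lemma nonneg_qser1 (d : nat) (e e' : int -> int) : finfib e ->
  (forall i, e i = d%:Z * e' i) -> e 0 = 0 -> nonneg_pos0 d (qser e (fun=> 1)).
Proof.
move=> fe ee' e0; split; last first.
  by rewrite /= (fsbigD1 0) //= ltr_pwDl // fsumr_ge0.
move=> n; split; first exact: fsumr_ge0.
move=> dn; apply: fsbig1 => i /= ei; case/negP: dn.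
by rewrite -[n]/(absz n%:Z) -ei ee' abszM dvdn_mulr.
Qed.

Lemma nonneg_phiq d : (0 < d)%N -> nonneg_pos0 d (phiq d).
Proof.
move=> d0; apply: nonneg_qser1 => //; last by rewrite mulr0.
by apply: finfib_int => j; apply: (square_ge j d0).2.
Qed.

Lemma nonneg_psiq d : (0 < d)%N -> nonneg_pos0 d (psiq d).
Proof.
move=> d0; apply: nonneg_qser1 => //; last by rewrite mul0r mulr0.
by apply: finfib_int => j; apply: (pronic_ge j d0).2.
Qed.

Lemma nonneg_pos0_dvd d d' f : (d %| d')%N -> nonneg_pos0 d' f -> nonneg_pos0 d f.
Proof.
move=> dd [nf f0]; split => // n; split; first exact: (nf n).1.
by move=> dn; apply: (nf n).2; apply: contra dn; apply: dvdn_trans.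
Qed.

(** With inverses as independent letters, the passage from [eulerf1_cube] to the dissection is
    polynomial algebra. Each part is arranged as a product of inverses, theta series and ratios such
    as [f8 * i4], to which the nonnegativity lemmas apply. *)
Lemma four_dissection_algebra (R : comNzRingType)
    (x f1 f3 f4 f8 f12 f16 f24 f48 i3 i4 i8 i12 i16 i24 i48 phi psi ph ps : R) :
  f3 * i3 = 1 -> f4 * i4 = 1 -> f8 * i8 = 1 -> f12 * i12 = 1 ->
  f16 * i16 = 1 -> f24 * i24 = 1 -> f48 * i48 = 1 ->
  psi * f16 * f24 = - 2 * f8 ^+ 2 * f48 ->
  phi * f8 * f12 * f48 = 2 * f4 * f16 * f24 ^+ 2 ->
  2 * f1 ^+ 3 * f12 = f3 * (2 * f4 ^+ 3 + 3 * f12 * (x * (psi * ph) + x ^+ 3 * (phi * ps))) ->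
  f1 ^+ 3 * (i4 ^+ 4 * i3) *+ 2 =
    i4 * i12 *+ 2
    - x ^+ 1 * (i4 * (i4 * (f8 * i4) * (f8 * i4) * i16 * (f48 * i24) * ph)) *+ 6
    + x ^+ 3 * (i4 * (i4 * (f16 * i8) * (f24 * i12) * (f24 * i12) * (f12 * i4) * i48 * ps)) *+ 6.
Proof.
move=> v3 v4 v8 v12 v16 v24 v48 s4 p4 c.
have S : psi = - 2 * f8 ^+ 2 * f48 * i16 * i24.
  transitivity (psi * (f16 * i16) * (f24 * i24)).
    by rewrite v16 v24 !mulr1.
  transitivity ((psi * f16 * f24) * (i16 * i24)); first by ring.
  by rewrite s4; ring.
have P : phi = 2 * f4 * f16 * f24 ^+ 2 * i8 * i12 * i48.
  transitivity (phi * (f8 * i8) * (f12 * i12) * (f48 * i48)).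
    by rewrite v8 v12 v48 !mulr1.
  transitivity ((phi * f8 * f12 * f48) * (i8 * i12 * i48)); first by ring.
  by rewrite p4; ring.
transitivity (2 * f1 ^+ 3 * f12 * i12 * (i4 ^+ 4 * i3)).
  by rewrite -(mulrA _ f12) v12; ring.
rewrite c S P.
transitivity ((f3 * i3) * ((f4 * i4) ^+ 3 * i4 * i12 *+ 2
  - (f12 * i12) * x ^+ 1 * (i4 ^+ 4 * f8 ^+ 2 * f48 * i16 * i24 * ph) *+ 6
  + (f12 * i12) * x ^+ 3 * ((f4 * i4) * (i4 ^+ 3 * f16 * f24 ^+ 2 * i8 * i12 * i48 * ps)) *+ 6)).
  by ring.
rewrite v3 v4 v12 !mul1r expr1n mul1r; congr (_ - _ + _).
  by ring.
(* The target contains [f12 * i4] and a second [i12], so the unit [f12 * i12] is put back. *)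
transitivity (x ^+ 3 * (f12 * i12 * (i4 ^+ 3 * f16 * f24 ^+ 2 * i8 * i12 * i48 * ps)) *+ 6).
  by rewrite v12 mul1r.
by ring.
Qed.

Lemma fcoefMn (f : fps int) k n : (f *+ k) n = k%:R * f n.
Proof.
elim: k => [|k IHk]; first by rewrite mulr0n mul0r.
by rewrite !mulrS fcoefD IHk mulrDl mul1r.
Qed.

Lemma four_dissection : exists A0 A1 A3 : fps int,
  [/\ positive 4 A0, positive 4 A1, positive 4 A3 &
      eulerf 1 ^+ 3 / (eulerf 3 * eulerf 4 ^+ 4) *+ 2 =
      A0 *+ 2 - q ^+ 1 * A1 *+ 6 + q ^+ 3 * A3 *+ 6].
Proof.
have V j : eulerf j * (eulerf j)^-1 = 1 by rewrite mulrV ?eulerf_unit.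
have pos4 : positive 4 (eulerf 4)^-1 by apply: positive_eulerfV.
have nn4 : nonneg_pos0 4 (eulerf 4)^-1 by apply: positive_nonneg_pos0.
have nn j : (0 < j)%N -> nonneg_pos0 4 (eulerf (4 * j))^-1.
  by move=> j0; apply: nonneg_eulerfV; [lia | apply: dvdn_mulr].
have rt m j : (0 < m)%N -> (0 < j)%N ->
    nonneg_pos0 4 (eulerf (m * (4 * j)) / eulerf (4 * j)).
  by move=> m0 j0; apply: nonneg_eulerf_ratio; [|lia|apply: dvdn_mulr].
have M := @nonneg_pos0M 4.
have r84 : nonneg_pos0 4 (eulerf 8 / eulerf 4) by exact: (rt 2 1).
have r48 : nonneg_pos0 4 (eulerf 48 / eulerf 24) by exact: (rt 2 6).
have r16 : nonneg_pos0 4 (eulerf 16 / eulerf 8) by exact: (rt 2 2).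
have r24 : nonneg_pos0 4 (eulerf 24 / eulerf 12) by exact: (rt 2 3).
have r12 : nonneg_pos0 4 (eulerf 12 / eulerf 4) by exact: (rt 3 1).
have i16 : nonneg_pos0 4 (eulerf 16)^-1 by exact: (nn 4).
have i48 : nonneg_pos0 4 (eulerf 48)^-1 by exact: (nn 12).
have f12 : nonneg_pos0 4 (phiq 12).
  by apply: (@nonneg_pos0_dvd 4 12) => //; apply: nonneg_phiq.
have g12 : nonneg_pos0 4 (psiq 12).
  by apply: (@nonneg_pos0_dvd 4 12) => //; apply: nonneg_psiq.
have s4 : psi3q 4 * eulerf 16 * eulerf 24 = - 2 * eulerf 8 ^+ 2 * eulerf 48.
  exact: (@psi3qE 4).
have p4 : phi3q 4 * eulerf 8 * eulerf 12 * eulerf 48 =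
    2 * eulerf 4 * eulerf 16 * eulerf 24 ^+ 2 by exact: (@phi3qE 4).
(* In each witness one factor [(eulerf 4)^-1] is set aside: it is positive at every multiple of 4,
   and the cofactor only has to be nonnegative with positive constant term. *)
exists ((eulerf 4)^-1 * (eulerf 12)^-1).
exists ((eulerf 4)^-1 * ((eulerf 4)^-1 * (eulerf 8 / eulerf 4) * (eulerf 8 / eulerf 4)
  * (eulerf 16)^-1 * (eulerf 48 / eulerf 24) * phiq 12)).
exists ((eulerf 4)^-1 * ((eulerf 4)^-1 * (eulerf 16 / eulerf 8) * (eulerf 24 / eulerf 12)
  * (eulerf 24 / eulerf 12) * (eulerf 12 / eulerf 4) * (eulerf 48)^-1 * psiq 12)).
split.
- exact: positiveM (nn 3 _).
- exact: positiveM pos4 (M _ _ (M _ _ (M _ _ (M _ _ (M _ _ nn4 r84) r84) i16) r48) f12).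
- exact: positiveM pos4
    (M _ _ (M _ _ (M _ _ (M _ _ (M _ _ (M _ _ nn4 r16) r24) r24) r12) i48) g12).
rewrite invrM ?unitrX ?eulerf_unit // -exprVn.
clear i16 i48 r84 r48 r16 r24 r12 pos4 nn4 nn rt M.
have := V 3; have := V 4; have := V 8; have := V 12.
have := V 16; have := V 24; have := V 48.
move: (eulerf 3)^-1 (eulerf 4)^-1 (eulerf 8)^-1 (eulerf 12)^-1 (eulerf 16)^-1
  (eulerf 24)^-1 (eulerf 48)^-1 => i3 i4 i8 i12 i16 i24 i48 v48 v24 v16 v12 v8 v4 v3.
exact: four_dissection_algebra v3 v4 v8 v12 v16 v24 v48 s4 p4 eulerf1_cube.
Qed.

Theorem theorem4p9 (n : nat) :
  [/\ 0 < a133144 (4 * n)%N,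
      a133144 (4 * n + 1)%N < 0,
      a133144 (4 * n + 2)%N = 0
    & 0 < a133144 (4 * n + 3)%N].
Proof.
have [A0 [A1 [A3 [[n0 p0] [n1 p1] [n3 p3] dis]]]] := four_dissection.
have aE m : 2 * a133144 m = 2 * A0 m - 6 * (q ^+ 1 * A1) m + 6 * (q ^+ 3 * A3) m.
  have := congr1 (fun f : fps int => f m) dis.
  by rewrite fcoefMn fcoefD fcoefB !fcoefMn.
(* A series in [q ^+ 4] shifted by [q ^+ k] lives on exponents congruent to [k] modulo 4. The three
   parts thus occupy the classes 0, 1 and 3 separately, and nothing falls in class 2. *)
have Z (A : fps int) k m : nonneg 4 A -> (k <= m -> ~~ (4 %| m - k))%N ->
    (q ^+ k * A) m = 0.
  by move=> nA m4; rewrite fcoefXM; case: leqP => // /m4 /(nA _).2.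
have Z0 m : ~~ (4 %| m)%N -> A0 m = 0 by apply: (n0 m).2.
split.
- have := aE (4 * n)%N; rewrite (Z A1) ?(Z A3) //; try lia.
  by have := p0 n; lia.
- have := aE (4 * n + 1)%N; rewrite Z0 ?(Z A3) //; try lia.
  by rewrite fcoefXM leq_addl addnK; have := p1 n; lia.
- by have := aE (4 * n + 2)%N; rewrite Z0 ?(Z A1) ?(Z A3) //; lia.
- have := aE (4 * n + 3)%N; rewrite Z0 ?(Z A1) //; try lia.
  by rewrite fcoefXM leq_addl addnK; have := p3 n; lia.
Qed.
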